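(* Let $k$ be a positive integer and let $G$ be a graph. If $G$ is proportionally $k$-choosable, then $G$ is proportionally $(k+1)$-choosable.
   Context: All graphs are finite and simple. For a positive integer $k$, a $k$-assignment $L$ for a graph $G$ assigns to each vertex $v$ a set $L(v)$ of exactly $k$ colors; its palette is $\mathcal{L} = \bigcup_{v \in V(G)} L(v)$, and for $c \in \mathcal{L}$, $\eta(c) = |\{v \in V(G) : c \in L(v)\}|$. A proper $L$-coloring of $G$ is a proper coloring $f$ of $G$ with $f(v) \in L(v)$ for every vertex $v$. It is a proportional $L$-coloring if for every $c \in \mathcal{L}$, $|f^{-1}(c)|$ equals $\lfloor \eta(c)/k \rfloor$ or $\lceil \eta(c)/k \rceil$. $G$ is proportionally $k$-choosable if a proportional $L$-coloring of $G$ exists for every $k$-assignment $L$ for $G$. *)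

(* Defs.v *)
From mathcomp Require Import all_boot.

Set Implicit Arguments.
Unset Strict Implicit.
Unset Printing Implicit Defensive.

(* A finite simple graph is a finType V of vertices together with a symmetric,
   irreflexive adjacency relation e : rel V; symmetry and irreflexivity are
   hypotheses of the theorem. *)

Definition ceil_divn (m d : nat) : nat := (m + d.-1) %/ d.

Lemma ceil_divn_leq (m d q : nat) : 0 < d -> (ceil_divn m d <= q) = (m <= q * d).
Proof.
case: d => // d _.
by rewrite /ceil_divn -ltnS ltn_divLR // mulSn addSn /= addnC ltnS leq_add2l.
Qed.

Section ListAssignments.

Variables (V C : finType) (e : rel V) (k : nat) (L : V -> {set C}).

Definition is_assignment : Prop := forall v : V, #|L v| = k.

(* The ambient type C may contain colors outside the palette. *)
Definition palette : {set C} := \bigcup_(v : V) L v.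

Definition eta (c : C) : nat := #|[set v : V | c \in L v]|.

Definition proper_L_coloring (f : V -> C) : Prop :=
  (forall u v : V, e u v -> f u <> f v) /\ (forall v : V, f v \in L v).

Definition proportional_L_coloring (f : V -> C) : Prop :=
  proper_L_coloring f /\
  (forall c : C, c \in palette ->
     #|f @^-1: [set c]| = eta c %/ k \/ #|f @^-1: [set c]| = ceil_divn (eta c) k).

End ListAssignments.

(* Colors range over an arbitrary finite type: the palette of an assignment of
   finite lists to finitely many vertices is always finite. *)
Definition proportionally_choosable (V : finType) (e : rel V) (k : nat) : Prop :=
  forall (C : finType) (L : V -> {set C}),
    is_assignment k L -> exists f : V -> C, proportional_L_coloring e k L f.

(* Main.v *)
(* Write d = k + 1.  Every d-assignment L admits a selection f, with f v in
   L v but not necessarily proper, using each color c either floor (eta c / d)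
   or ceil (eta c / d) times: if a color is used too often (too rarely), double
   counting over the colors reachable from it (reaching it) in the digraph
   "some v with f v = a has b in L v" gives a path along which recoloring
   improves f.  Deleting f v from each L v leaves a k-assignment, and rounding
   (eta c - #f^-1(c)) / k yields floor (eta c / d) or ceil (eta c / d) again. *)
Require Import Defs.
From mathcomp Require Import all_boot.
From mathcomp Require Import zify.

Set Implicit Arguments.
Unset Strict Implicit.
Unset Printing Implicit Defensive.

(* Division-free form of: n is the floor or the ceiling of m / d. *)
Definition rounds (d m n : nat) : bool := (m < n.+1 * d) && (n * d < m + d).

Lemma roundsP (d m n : nat) : 0 < d ->
  reflect (n = m %/ d \/ n = ceil_divn m d) (rounds d m n).
Proof.
move=> d_gt0; have ceilP q := ceil_divn_leq m q d_gt0.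
have ceil_ge := ceilP (ceil_divn m d); rewrite leqnn in ceil_ge.
have ceil_lt : ceil_divn m d * d < m + d.
  by have := leq_divM (m + d.-1) d; rewrite -/(ceil_divn m d); lia.
have floor_le := leq_divM m d; have floor_gt := ltn_ceil m d_gt0.
apply: (iffP andP) => [[m_lt n_lt] | [] ->]; last by split; lia.
- have floor_n : m %/ d <= n by rewrite -ltnS ltn_divLR.
  have n_ceil : n <= ceil_divn m d.
    by rewrite -ltnS -(ltn_pmul2r d_gt0) mulSn; lia.
  have ceil_floor : ceil_divn m d <= (m %/ d).+1 by rewrite ceilP; lia.
  by lia.
- by split; lia.
Qed.

(** The bounds on [a] place [m - a] between [(a - 1) * k] and [(a + 1) * k], so [b] differs from [a]
    by at most one; each of the three remaining cases is linear. *)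
Lemma rounds_sub (k m a b : nat) : 0 < k -> a <= m ->
  rounds k.+1 m a -> rounds k (m - a) b -> rounds k.+1 m b.
Proof.
move=> k_gt0 le_am /andP[a1 a2] /andP[b1 b2]; apply/andP.
have [lt_ab|le_ba] := ltnP a.+1 b.
  by have := leq_mul lt_ab (leqnn k); split; lia.
have [lt_ba|le_ab] := ltnP b.+1 a.
  by have := leq_mul lt_ba (leqnn k); split; lia.
have : b = a \/ b = a.+1 \/ a = b.+1 by lia.
by case=> [|[]] ?; subst; split; lia.
Qed.

Section Selections.

Variables (V C : finType) (L : V -> {set C}).
Implicit Types (f g : V -> C) (S : {pred C}).

Definition selection f := forall v, f v \in L v.

Definition uses f (c : C) : nat := #|f @^-1: [set c]|.

Lemma usesE f c : uses f c = \sum_v (f v == c).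
Proof.
rewrite /uses -sum1_card big_mkcond /=.
by apply: eq_bigr => v _; rewrite !inE; case: eqP.
Qed.

Lemma etaE c : eta L c = \sum_v (c \in L v).
Proof.
rewrite /eta -sum1_card big_mkcond /=.
by apply: eq_bigr => v _; rewrite inE; case: (_ \in _).
Qed.

Lemma sum_uses f S : \sum_(c in S) uses f c = \sum_v (f v \in S).
Proof.
under eq_bigr do rewrite usesE.
rewrite exchange_big; apply: eq_bigr => v _ /=.
rewrite big_mkcond (bigD1 (f v)) //= eqxx big1 ?addn0; first by case: (_ \in _).
by move=> c /negPf ne; rewrite eq_sym ne if_same.
Qed.

Lemma sum_eta S : \sum_(c in S) eta L c = \sum_v #|[predI S & L v]|.
Proof.
under eq_bigr do rewrite etaE.
rewrite exchange_big; apply: eq_bigr => v _ /=.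
rewrite -sum1_card big_mkcond [RHS]big_mkcond /=.
by apply: eq_bigr => c _; rewrite !inE; case: (c \in S); case: (c \in L v).
Qed.

Definition recolorable f : rel C :=
  fun a b => [exists v, (f v == a) && (b \in L v)].

(* The path is duplicate-free, so its steps recolor different vertices. *)
Lemma shift_path f x p : selection f -> path (recolorable f) x p ->
    uniq (x :: p) ->
  exists g, [/\ selection g, forall v, f v \notin x :: p -> g v = f v &
    forall c, uses g c + (c == x) = uses f c + (c == last x p)].
Proof.
move=> selL; elim: p x => [|y p IHp] x; first by move=> _ _; exists f.
move=> /andP[/existsP[v /andP[/eqP fv yLv]] yp] /andP[x_yp uniq_yp].
have [g [selg eqg usesg]] := IHp y yp uniq_yp.
(* The tail is shifted first. As [x] does not lie on it, [v] still has color [x] under [g], and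
   giving it [y] moves exactly one use from [x] to [y]. *)
have gv : g v = x by rewrite eqg fv.
exists (fun u => if u == v then y else g u); split=> [u | u | c].
- by case: eqP => [->|_].
- rewrite inE negb_or => /andP[fu u_yp]; rewrite eqg //.
  by case: eqP => // eq_uv; rewrite eq_uv fv eqxx in fu.
have := usesg c; rewrite !usesE (bigD1 v) //= gv.
rewrite [in X in _ -> X](bigD1 v) //= eqxx.
under [in X in _ -> X]eq_bigr => u /negPf-> do [].
rewrite (eq_sym y) (eq_sym x).
by lia.
Qed.

Lemma shift_connect f x y : selection f -> connect (recolorable f) x y ->
  exists2 g, selection g & forall c, uses g c + (c == x) = uses f c + (c == y).
Proof.
move=> self /connectP[p /shortenP[q xq uniq_q _] ->].
by have [g [selg _ usesg]] := shift_path self xq uniq_q; exists g.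
Qed.

Variable d : nat.
Hypothesis cardL : is_assignment d L.

(** The set [S] of colors reachable from [x] is closed: if [f v] is in [S], so is all of [L v].
    Hence [d] times the uses of [S] is at most the sum of [eta] over [S], and a surplus at [x]
    forces a deficit elsewhere in [S]. *)
Lemma underused_reachable f x : selection f -> eta L x < uses f x * d ->
  exists2 y, connect (recolorable f) x y & uses f y * d < eta L y.
Proof.
move=> self over_x; set S := connect (recolorable f) x.
apply/exists_inP; apply: contraLR over_x.
move=> /exists_inPn all_over; rewrite -leqNgt -(leq_add2r
  (\sum_(c in S | c != x) uses f c * d)).
have Sx : x \in S by apply: connect0.
rewrite -bigD1 //= -big_distrl /= sum_uses big_distrl /=.
apply: (@leq_trans (\sum_(c in S) eta L c)).
  rewrite sum_eta; apply: leq_sum => v _.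
  case Sfv: (f v \in S) => //; rewrite mul1n -(cardL v).
  apply/subset_leq_card/subsetP => b bLv; rewrite inE /= bLv andbT.
  apply: connect_trans Sfv (connect1 _).
  by apply/existsP; exists v; rewrite eqxx.
rewrite (bigD1 x) //= leq_add2l leq_sum // => c /andP[Sc _].
by rewrite leqNgt all_over.
Qed.

(** Dually, if [f v] does not reach [y], no color of [L v] does. Only vertices colored from [S]
    contribute to [eta] over [S], each at most [d]. *)
Lemma overused_reaching f y : selection f -> uses f y * d < eta L y ->
  exists2 x, connect (recolorable f) x y & eta L x < uses f x * d.
Proof.
move=> self under_y; pose S := [pred x | connect (recolorable f) x y].
apply/(@exists_inP _ S); apply: contraLR under_y.
move=> /exists_inPn all_under; rewrite -leqNgt -(leq_add2r
  (\sum_(c in S | c != y) eta L c)).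
have Sy : y \in S by apply: connect0.
rewrite -bigD1 //=.
apply: (@leq_trans (\sum_(c in S) uses f c * d)); last first.
  rewrite (bigD1 y) //= leq_add2l leq_sum // => c /andP[Sc _].
  by rewrite leqNgt all_under.
rewrite -big_distrl /= sum_uses big_distrl /= sum_eta.
apply: leq_sum => v _; case Sfv: (f v \in S).
  rewrite mul1n -(cardL v); apply/subset_leq_card/subsetP => b.
  by rewrite inE => /andP[].
rewrite leqn0; apply/eqP/eq_card0 => b; apply/negP; rewrite inE => /andP[Sb bLv].
move/negP: Sfv; apply; apply: connect_trans (connect1 _) Sb.
by apply/existsP; exists v; rewrite eqxx.
Qed.

(** With truncated subtraction, the first summand is positive exactly above the ceiling and the
    second exactly below the floor. *)
Definition deviation f (c : C) : nat :=
  ((uses f c * d).+1 - (eta L c + d)) + ((eta L c).+1 - (uses f c).+1 * d).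

Lemma deviation_eq0 f c : (deviation f c == 0) = rounds d (eta L c) (uses f c).
Proof. by rewrite addn_eq0 !subn_eq0 andbC. Qed.

(** Moving one use cannot push [x] below its floor or [y] above its ceiling, since [x] starts
    strictly above and [y] strictly below [eta / d]. Neither deviation grows, and a positive one
    drops. *)
Lemma improve_selection f x y : 0 < d -> selection f ->
    connect (recolorable f) x y ->
    eta L x < uses f x * d -> uses f y * d < eta L y ->
    0 < deviation f x + deviation f y ->
  exists2 g, selection g &
    \sum_c deviation g c < \sum_c deviation f c.
Proof.
move=> d_gt0 self xy over_x under_y dev_gt0.
have ne_xy : y != x by apply: contraTneq under_y => ->; rewrite -leqNgt ltnW.
have [g selg usesg] := shift_connect self xy; exists g => //.
rewrite (bigD1 x) // (bigD1 y) //= [ltnRHS](bigD1 x) // [in ltnRHS](bigD1 y) //=.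
have -> : \sum_(c | (c != x) && (c != y)) deviation g c =
          \sum_(c | (c != x) && (c != y)) deviation f c.
  apply: eq_bigr => c /andP[/negPf cx /negPf cy].
  by have := usesg c; rewrite cx cy !addn0 /deviation => ->.
rewrite !addnA ltn_add2r; move: dev_gt0; rewrite /deviation.
have := usesg x; have := usesg y.
rewrite !eqxx (negPf ne_xy) eq_sym (negPf ne_xy) !addn0 => -> uses_x.
move: over_x; rewrite -uses_x.
by lia.
Qed.

Lemma balanced_selection : 0 < d ->
  exists2 f, selection f & forall c, rounds d (eta L c) (uses f c).
Proof.
move=> d_gt0.
(* Selections are taken as finite functions so that one of least total deviation can be picked. *)
have [f0 self0] : exists f0 : {ffun V -> C}, selection f0.
  have /fin_all_exists[f fL] v : exists c, c \in L v.
    by apply/set0Pn; rewrite -card_gt0 cardL.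
  by exists (finfun f) => v; rewrite ffunE.
pose sel (f : {ffun V -> C}) := [forall v, f v \in L v].
have sel0 : sel f0 by apply/forallP.
have [f /forallP self minf] :=
  arg_minnP (fun f : {ffun V -> C} => \sum_c deviation f c) sel0.
exists f => // c; rewrite -deviation_eq0.
have no_improvement : ~ exists2 g, selection g &
    \sum_c deviation g c < \sum_c deviation f c.
  case=> g selg; rewrite ltnNge => /negP; apply.
  have dev_g a : deviation (finfun g) a = deviation g a.
    rewrite /deviation /uses; have -> // : finfun g @^-1: [set a] = g @^-1: [set a].
    by apply/setP => v; rewrite !inE ffunE.
  have /= := minf (finfun g); under [X in _ <= X] eq_bigr do rewrite dev_g.
  by apply; apply/forallP => v; rewrite ffunE.
case: posnP => // dev_gt0; case: no_improvement.
have [over_c | under_c] : eta L c < uses f c * d \/ uses f c * d < eta L c.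
  by move: dev_gt0; rewrite /deviation; lia.
- have [y cy under_y] := underused_reachable self over_c.
  by apply: improve_selection cy over_c under_y _ => //; rewrite addn_gt0 dev_gt0.
- have [x xc over_x] := overused_reaching self under_c.
  apply: improve_selection xc over_x under_c _ => //.
  by rewrite addn_gt0 dev_gt0 orbT.
Qed.

Lemma eta_delete f c : selection f ->
  eta (fun v => L v :\ f v) c + uses f c = eta L c.
Proof.
move=> self; rewrite etaE usesE /eta -sum1_card big_mkcond -big_split /=.
apply: eq_bigr => v _; rewrite !inE eq_sym.
by case: eqP => [<-|_]; rewrite ?self //= addn0; case: (_ \in _).
Qed.

Lemma uses_notin_palette f c :
  selection f -> c \notin palette L -> eta L c = 0 /\ uses f c = 0.
Proof.
move=> self c_notin.
have cL v : c \in L v = false.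
  by apply: contraNF c_notin => cLv; apply/bigcupP; exists v.
split; apply: eq_card0 => v; rewrite !inE ?cL //.
by apply/eqP => fv; have := self v; rewrite fv cL.
Qed.

End Selections.

Theorem proposition20 (k : nat) (hk : 0 < k)
    (V : finType) (e : rel V) (e_sym : symmetric e) (e_irr : irreflexive e) :
  proportionally_choosable e k -> proportionally_choosable e k.+1.
Proof.
move=> choose_k C L cardL.
have [f self roundf] := balanced_selection cardL (ltn0Sn k).
have cardL' : is_assignment k (fun v => L v :\ f v).
  by move=> v; have := cardsD1 (f v) (L v); rewrite self cardL => -[].
have [g [[properg selg] propg]] := choose_k C _ cardL'.
exists g; split; first by split=> // v; have := selg v; rewrite inE => /andP[].
move=> c _; apply/(roundsP _ _ (ltn0Sn k)).
have etaL := eta_delete c self.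
apply: (rounds_sub hk _ (roundf c)); first by rewrite -etaL leq_addl.
rewrite -etaL addnK; apply/(roundsP _ _ hk).
have [/propg // | c_notin] := boolP (c \in palette (fun v => L v :\ f v)).
have [eta0 uses0] := uses_notin_palette selg c_notin.
by left; rewrite eta0 div0n.
Qed.
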